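(* Let $n\in\mathbb{N}$, $a>1$ and $\lambda>0$, and let $(h_j(n))$ be a real-valued sequence with $|h_j(n)|\le 1$ for all $n$ and all $j\in\mathbb{N}_0$. Let the input set be $\{z_j\}_{j=0}^n=\{-ih_j(n)\}_{j=0}^n$. Consider the problem of finding an output vector $\mathbf{w}=\{w_k\}_{k=0}^n$ such that the superoscillating sequence $$f_n(z)=\sum_{j=0}^{n}Z_j(n,a)\,B(z,-ih_j(n))$$ solves the learning problem $$f_*=\arg\min_{f\in\mathcal{F}(\mathbb{C})}J(f),\qquad J(f)=\sum_{k=0}^n|w_k-f(z_k)|^2+\lambda\|f\|^2,\quad f\in\mathcal{F}(\mathbb{C}).$$ The components of the vector $\mathbf{w}=\{w_k\}_{k=0}^n$ that solves this problem are given by $$w_k=\sum_{j=0}^{n}Z_j(n,a)\,e^{h_j(n)h_k(n)}+\lambda Z_k(n,a),\qquad 0\le k\le n.$$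
   Context: The Fock space $\mathcal{F}(\mathbb{C})$ is the Hilbert space of entire functions $f$ with $\|f\|^2=\frac1\pi\int_{\mathbb{C}}|f(z)|^2e^{-|z|^2}\,dA(z)<\infty$, where $dA=dx\,dy$ for $z=x+iy$. Its reproducing kernel is $B(z,w)=e^{z\overline{w}}$, so that $B(z,-ih_j(n))=e^{ih_j(n)z}$. The coefficients $Z_j(n,a)$ are complex-valued. A sequence $f_n(x)=\sum_{j=0}^nZ_j(n,a)e^{ih_j(n)x}$, $x\in\mathbb{R}$, is called superoscillating if $|h_j(n)|\le1$ for all $n$ and $j$ and there is a compact subset of $\mathbb{R}$ on which $f_n(x)$ converges uniformly to $e^{ig(a)x}$, where $g$ is a continuous real-valued function with $|g(a)|>1$; $f_n(z)$ denotes its extension to entire functions of $z\in\mathbb{C}$.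
   Formalization: That the displayed w solves the problem is shown for all inputs; that it is the only solving w is shown only when the points z_0,…,z_n are pairwise distinct, since otherwise w is not unique (e.g. n=1, h_0=h_1=0, Z=(0,0), w=(1,−1)). *)

(* Defs.v *)
From HB Require Import structures.
From mathcomp Require Import all_boot all_order all_algebra.
From mathcomp Require Import complex.
From mathcomp Require Import all_classical all_reals all_analysis.

Set Implicit Arguments.
Unset Strict Implicit.
Unset Printing Implicit Defensive.

Import Order.TTheory GRing.Theory Num.Theory.
Import numFieldNormedType.Exports.
Import ComplexField.Normc.

Local Open Scope classical_set_scope.
Local Open Scope ring_scope.
Local Open Scope complex_scope.

Section FockLearning.
Context {R : realType}.

(* [complex.Re] and [complex.Im] are R-valued, and so is the modulus [normc]. *)
Definition cexp (z : R[i]) : R[i] :=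
  (expR (complex.Re z) * cos (complex.Im z))
  +i* (expR (complex.Re z) * sin (complex.Im z)).

(* R[i]^o is R[i] seen as a normed module over itself, so that derivability
   is with respect to a complex increment. *)
Definition entire (f : R[i] -> R[i]) : Prop :=
  forall z : R[i], derivable (f : R[i]^o -> R[i]^o) z 1.

Definition fock_normsq (f : R[i] -> R[i]) : \bar R :=
  ((pi : R)^-1%:E *
   \int[(@lebesgue_measure R \x @lebesgue_measure R)]_p
     (normc (f (p.1 +i* p.2)) ^+ 2
      * expR (- normc (p.1 +i* p.2) ^+ 2))%:E)%E.

Definition fock : set (R[i] -> R[i]) :=
  [set f | entire f /\ (fock_normsq f < +oo)%E].

Definition fock_kernel (z w : R[i]) : R[i] := cexp (z * w^*%C).

Definition argmin (T : Type) (F : set T) (J : T -> R) : set T :=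
  [set f | F f /\ forall g, F g -> J f <= J g].

(* [fine] is harmless: J is only minimized over [fock], where the norm is
   finite. *)
Definition reg_loss (n : nat) (zs w : 'I_n.+1 -> R[i]) (lambda : R)
    (f : R[i] -> R[i]) : R :=
  \sum_(k < n.+1) normc (w k - f (zs k)) ^+ 2 + lambda * fine (fock_normsq f).

(* [h n j] is h_j(n) and [Z n j a] is Z_j(n,a). *)
Definition fock_seq (h : nat -> nat -> R) (Z : nat -> nat -> R -> R[i])
    (a : R) (n : nat) (z : R[i]) : R[i] :=
  \sum_(j < n.+1) Z n j a * fock_kernel z (- 'i%C * (h n j)%:C).

Definition superoscillating (h : nat -> nat -> R)
    (Z : nat -> nat -> R -> R[i]) (a : R) : Prop :=
  (forall n j, (0 < n)%N -> (j <= n)%N -> `|h n j| <= 1) /\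
  exists (g : R -> R) (K : set R),
    [/\ continuous g, 1 < `|g a|, compact K, K !=set0 &
      {uniform K,
        (fun n (x : R) =>
           \sum_(j < n.+1) Z n j a * cexp ('i%C * (h n j)%:C * x%:C) : R[i]^o)
          @ \oo --> (fun x : R => cexp ('i%C * (g a)%:C * x%:C) : R[i]^o)}].

End FockLearning.

(* Main.v *)
Require Import Defs.
From HB Require Import structures.
From mathcomp Require Import all_boot all_order all_algebra.
From mathcomp Require Import complex ring lra.
From mathcomp Require Import all_classical all_reals all_analysis.
From mathcomp Require Import measurable_realfun.

Set Implicit Arguments.
Unset Strict Implicit.
Unset Printing Implicit Defensive.

Import Order.TTheory GRing.Theory Num.Theory.
Import numFieldNormedType.Exports.
Import ComplexField.Normc.

Local Open Scope classical_set_scope.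
Local Open Scope ring_scope.
Local Open Scope complex_scope.

(** Write [K_w] for the reproducing kernel at [w] and [f] for the combination
    [\sum_j Z_j K_(z_j)] whose optimality is at stake.  If [<g, K_w> = g w] for
    every [g] of the Fock space, then moving from [f] to [f + g] changes the
    loss by exactly
      [\sum_k |g z_k|^2 + lambda |g|^2 - 2 Re \sum_k (c_k)^* g z_k],
    where [c_k = w_k - f z_k - lambda Z_k]: the cross term [<g, f>] of the
    squared norm is [\sum_k (Z_k)^* g z_k], again a sum over the sample points
    ([reg_loss_expand]).  Since [K_(z_j) z_k = exp (h_j h_k)], the formula for
    [w] says that all [c_k] vanish.  In that case the change is nonnegative, and
    it is zero only for [g = 0].  Conversely, if [f] is a minimizer, the linear
    term vanishes in every direction [g] ([quadratic_ge0_lin0]); when the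
    [z_k] are distinct, some [g] vanishes at all of them but a chosen one
    ([fock_isolate]), which gives [c_k = 0].

    The substance is the reproducing property, to be derived for functions that
    are only known to have a complex derivative at each point.  After
    translating [w] to the origin and completing the square
    ([fock_kernel_recentre]) it becomes the Gaussian mean value property: the
    integral of [Re G] against [exp (- |u|^2)] is [pi * Re (G 0)], for [G]
    entire ([gaussian_mean]).  Rotations preserve area and the Gaussian weight,
    so the integral may be averaged over all rotations of [G], and after
    exchanging the two integrals the inner one is a circle mean of [G].

    Circle means equal [G 0] ([circle_mean]): the integral theorem for
    rectangles, which Goursat's bisection proves without continuity of the
    derivative ([Goursat_rectangle]), applied to the periodic function
    [zeta |-> G (exp zeta)] shows that they do not depend on the radius.  The
    invariance of area under rotations comes from that of the one-dimensional
    measure under translations, because a rotation is a product of three shears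
    ([area_preserving_rotation]).  Only real parts are ever integrated, since
    the loss involves real inner products only. *)

(** * Entire functions and the complex exponential *)
Section ComplexDifferentiability.
Context {R : realType}.
Implicit Types (f g : R[i] -> R[i]) (z w : R[i]).

Lemma normr_normc z : `|z| = (normc z)%:C. Proof. by case: z. Qed.

(** Complex differentiability as a first-order estimate with real constants:
    increments in the normed field of complex numbers have complex-valued
    norms, which this form removes. *)
Lemma entire_linear_approx f : entire f -> forall z, exists l : R[i],
  forall e : R, 0 < e -> exists2 d : R, 0 < d &
    forall w, normc (w - z) < d ->
      normc (f w - f z - l * (w - z)) <= e * normc (w - z).
Proof.
move=> ef z; have /cvg_ex[/= l fl] := ef z; exists l => e e0.
have eC : 0 < e%:C by rewrite ltcR.
have /cvgrPdist_le/(_ _ eC) := fl.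
move=> -[/= d]; rewrite ltcE /= => /andP[/eqP d2 d0] H.
exists (complex.Re d) => // w wd.
have dE : d = (complex.Re d)%:C by case: (d) d2 => a b /= ->.
have [->|wz] := eqVneq w z.
  by rewrite !subrr mulr0 subr0 normc0 mulr0.
have wz0 : w - z != 0 by rewrite subr_eq0.
have := H (w - z).
rewrite /ball_ /= sub0r normrN normr_normc dE ltcR => /(_ wd wz0).
rewrite normr_normc lecR /shift /= /GRing.scale /= mulr1 subrK => E.
have -> : f w - f z - l * (w - z) = - (l - (w - z)^-1 * (f w - f z)) * (w - z).
  by rewrite mulNr mulrBl mulrAC mulVf// mul1r opprB.
rewrite normcM normcN ler_wpM2r// /normc.
by case: (w - z) => a b; exact: sqrtr_ge0.
Qed.

Lemma linear_approx_entire f : (forall z, exists l : R[i],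
  forall e : R, 0 < e -> exists2 d : R, 0 < d &
    forall w, normc (w - z) < d ->
      normc (f w - f z - l * (w - z)) <= e * normc (w - z)) -> entire f.
Proof.
move=> H z; apply/cvg_ex; have [l Hl] := H z; exists l.
apply/cvgrPdist_le => /= e; rewrite ltcE /= => /andP[/eqP e2 e0].
have [d d0 Hd] := Hl _ e0.
have eE : e = (complex.Re e)%:C by case: (e) e2 => a b /= ->.
exists d%:C => /=; first by rewrite ltcR.
move=> h; rewrite /ball_ /= sub0r normrN normr_normc ltcR => hd h0.
rewrite normr_normc eE lecR /shift /= /GRing.scale /= mulr1.
have := Hd (h + z); rewrite addrK => /(_ hd) E.
have -> : l - h^-1 * (f (h + z) - f z) = - (h^-1 * (f (h + z) - f z - l * h)).
  by rewrite [in RHS]mulrBr (mulrCA h^-1 l) mulVf// mulr1 opprB.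
have n0 : 0 < normc h.
  by rewrite -ltcR -normr_normc normr_gt0.
by rewrite normcN normcM normcV mulrC ler_pdivrMr.
Qed.

Lemma entire_differentiable f :
  entire f <-> (forall z, differentiable (f : R[i]^o -> R[i]^o) (z : R[i]^o)).
Proof.
by split => ef z; [apply/derivable1_diffP; exact: ef|apply/derivable1_diffP].
Qed.

Lemma entire_cst (c : R[i]) : entire (fun=> c).
Proof. by move=> z; exact: derivable_cst. Qed.

Lemma entire_id : entire (@id R[i]).
Proof. by move=> z; exact: derivable_id. Qed.

Lemma entireD f g : entire f -> entire g -> entire (fun z => f z + g z).
Proof. by move=> ef eg z; exact: derivableD. Qed.

Lemma entireM f g : entire f -> entire g -> entire (fun z => f z * g z).
Proof. by move=> ef eg z; exact: (@derivableM R[i] R[i]^o). Qed.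

Lemma entire_comp f g : entire f -> entire g -> entire (fun z => f (g z)).
Proof.
move=> /entire_differentiable df /entire_differentiable dg.
apply/entire_differentiable => z.
exact: (@differentiable_comp R[i] R[i]^o R[i]^o R[i]^o).
Qed.

Lemma normc_ge0 z : 0 <= normc z.
Proof. by case: z => a b; exact: sqrtr_ge0. Qed.

Lemma sqr_normc_ReIm z :
  normc z ^+ 2 = complex.Re z ^+ 2 + complex.Im z ^+ 2.
Proof. by case: z => a b /=; rewrite sqr_sqrtr// addr_ge0// sqr_ge0. Qed.

Lemma ler_Re_normc z : `|complex.Re z| <= normc z.
Proof.
rewrite -(@ler_pXn2r _ 2)// ?nnegrE ?normc_ge0//.
by rewrite sqr_normc_ReIm real_normK ?num_real// lerDl sqr_ge0.
Qed.

Lemma ler_Im_normc z : `|complex.Im z| <= normc z.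
Proof.
rewrite -(@ler_pXn2r _ 2)// ?nnegrE ?normc_ge0//.
by rewrite sqr_normc_ReIm real_normK ?num_real// lerDr sqr_ge0.
Qed.

Lemma normc_le_ReIm z : normc z <= `|complex.Re z| + `|complex.Im z|.
Proof.
rewrite -(@ler_pXn2r _ 2)// ?nnegrE ?normc_ge0 ?addr_ge0//.
rewrite sqr_normc_ReIm sqrrD !real_normK ?num_real// lerD2r lerDl.
by rewrite mulrn_wge0// mulr_ge0.
Qed.

Lemma cexpD z w : cexp (z + w) = cexp z * cexp w.
Proof.
case: z w => a b [c d]; rewrite /cexp /= expRD sinD cosD.
by apply/eqP; rewrite eq_complex /=; apply/andP; split; apply/eqP; ring.
Qed.

Lemma cexp0 : cexp (0 : R[i]) = 1.
Proof. by rewrite /cexp /= expR0 cos0 sin0 !mul1r. Qed.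

Lemma normc_cexp z : normc (cexp z) = expR (complex.Re z).
Proof.
rewrite /cexp /= !exprMn -mulrDr cos2Dsin2 mulr1 sqrtr_sqr ger0_norm//.
Qed.

Lemma real_deriv_near0 (f : R -> R) (l : R) : is_derive (0 : R) (1 : R) f l ->
  forall e, 0 < e -> exists2 d : R, 0 < d &
    forall x, `|x| < d -> `|f x - f 0 - l * x| <= e * `|x|.
Proof.
move=> [df <-] e e0.
have /cvgrPdist_le/(_ _ e0) := df.
move=> -[/= d d0 H]; exists d => // x xd.
have [->|x0] := eqVneq x 0; first by rewrite subrr mulr0 subr0 normr0 mulr0.
have := H x; rewrite /ball_ /= sub0r normrN => /(_ xd x0).
rewrite /shift /= /GRing.scale /= mulr1 addr0 => E.
have -> : f x - f 0 - 'D_1 f 0 * x = - ('D_1 f 0 - x^-1 * (f x - f 0)) * x.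
  by rewrite mulNr mulrBl mulrAC mulVf// mul1r opprB.
by rewrite normrM normrN ler_wpM2r.
Qed.

(** By the functional equation only the derivative at 0 matters, where the real
    expansions of exp, cos and sin combine. *)
Lemma entire_cexp : entire (@cexp R).
Proof.
have near0 : forall e : R, 0 < e -> exists2 d : R, 0 < d &
    forall h, normc h < d -> normc (cexp h - 1 - h) <= e * normc h.
  move=> e e0; pose t := Num.min (e / 6) 1.
  have t0 : 0 < t by rewrite lt_min divr_gt0//=.
  have t1 : t <= 1 by rewrite ge_min lexx orbT.
  have te : t * 6 <= e.
    by rewrite -ler_pdivlMr// ge_min lexx.
  have [d1 d10 H1] := real_deriv_near0 (is_derive_expR 0) t0.
  have [d2 d20 H2] := real_deriv_near0 (is_derive_cos 0) t0.
  have [d3 d30 H3] := real_deriv_near0 (is_derive_sin 0) t0.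
  (* [t <= 1] and [|x| <= t / 2] absorb the products of the remainders *)
  exists (Num.min (Num.min d1 d2) (Num.min d3 (t / 2))) => [|h].
    by rewrite !lt_min d10 d20 d30 divr_gt0.
  rewrite !lt_min => /andP[/andP[h1 h2] /andP[h3 h4]].
  case: h h1 h2 h3 h4 => x y h1 h2 h3 h4.
  have xn := ler_Re_normc (x +i* y); have yn := ler_Im_normc (x +i* y).
  pose N := normc (x +i* y); rewrite -/N in xn yn h1 h2 h3 h4 *.
  rewrite /= in xn yn.
  have {}H1 := H1 x (le_lt_trans xn h1).
  have {}H2 := H2 y (le_lt_trans yn h2).
  have {}H3 := H3 y (le_lt_trans yn h3).
  rewrite expR0 mul1r in H1; rewrite cos0 sin0 oppr0 mul0r subr0 in H2.
  rewrite sin0 cos0 subr0 mul1r in H3.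
  have xt : `|x| <= t / 2 by exact: le_trans xn (ltW h4).
  have c1 : `|cos y| <= 1 by rewrite ler_norml cos_geN1 cos_le1.
  have s1 : `|sin y| <= 2 * `|y|.
    have -> : sin y = (sin y - y) + y by ring.
    apply: (le_trans (ler_normD _ _)).
    have := ler_wpM2r (normr_ge0 y) t1; lra.
  apply: (le_trans (normc_le_ReIm _)) => /=.
  rewrite !subr0.
  have -> : expR x * cos y - 1 - x
     = (expR x - 1 - x) * cos y + (1 + x) * (cos y - 1) by ring.
  have -> : expR x * sin y - y = (expR x - 1 - x) * sin y + x * sin y +
     (sin y - y) by ring.
  have A1 : `|(expR x - 1 - x) * cos y| <= t * `|x|.
    by rewrite normrM -[leRHS]mulr1 ler_pM.
  have A2 : `|(1 + x) * (cos y - 1)| <= 2 * (t * `|y|).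
    rewrite normrM ler_pM// (le_trans (ler_normD _ _))// normr1.
    lra.
  have A3 : `|(expR x - 1 - x) * sin y| <= (t * `|x|) * 1.
    by rewrite normrM ler_pM// ler_norml sin_geN1 sin_le1.
  have A4 : `|x * sin y| <= t / 2 * (2 * `|y|).
    by rewrite normrM ler_pM.
  have B1 := ler_normD ((expR x - 1 - x) * cos y) ((1 + x) * (cos y - 1)).
  have B2 := ler_normD ((expR x - 1 - x) * sin y + x * sin y) (sin y - y).
  have B3 := ler_normD ((expR x - 1 - x) * sin y) (x * sin y).
  have C1 := ler_wpM2l (ltW t0) xn.
  have C2 := ler_wpM2l (ltW t0) yn.
  have C3 : t * 6 * N <= e * N by rewrite ler_wpM2r// (le_trans _ xn).
  lra.
apply: linear_approx_entire => z; exists (cexp z) => e e0.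
have nz0 : 0 < normc (cexp z) by rewrite normc_cexp expR_gt0.
have [d d0 H] := near0 _ (divr_gt0 e0 nz0).
exists d => // w wd; have {}H := H _ wd.
have -> : cexp w - cexp z - cexp z * (w - z)
    = cexp z * (cexp (w - z) - 1 - (w - z)).
  by rewrite -{1}(subrKC z w) (cexpD z); ring.
rewrite normcM -ler_pdivlMl// (le_trans H)// mulrA.
by rewrite (mulrC _ e).
Qed.

End ComplexDifferentiability.

(** * Goursat bisection and the mean value property on circles *)
Section Bisection.
Context {R : realType}.

(** Nested rectangles: a property that always passes to some quarter of a
    rectangle concentrates at a point.  Both sides are halved at each step. *)
Lemma bisection (P : R -> R -> R -> R -> Prop) :
  (forall a b c d, a <= b -> c <= d -> P a b c d ->
    exists a' b' c' d', [/\ P a' b' c' d', a <= a' /\ b' <= b,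
      c <= c' /\ d' <= d, b' - a' = (b - a) / 2 & d' - c' = (d - c) / 2]) ->
  forall a b c d, a <= b -> c <= d -> P a b c d ->
  exists x y, forall e, 0 < e -> exists a' b' c' d',
    [/\ P a' b' c' d', a' <= x <= b', c' <= y <= d', b' - a' < e & d' - c' < e].
Proof.
move=> step a0 b0 c0 d0 ab0 cd0 P0.
pose Q (r : R * R * (R * R)) :=
  [/\ r.1.1 <= r.1.2, r.2.1 <= r.2.2 & P r.1.1 r.1.2 r.2.1 r.2.2].
pose sub (r s : R * R * (R * R)) :=
  [/\ Q s, r.1.1 <= s.1.1 /\ s.1.2 <= r.1.2,
   r.2.1 <= s.2.1 /\ s.2.2 <= r.2.2,
   s.1.2 - s.1.1 = (r.1.2 - r.1.1) / 2 & s.2.2 - s.2.1 = (r.2.2 - r.2.1) / 2].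
have /choice[nxt nxtP] : forall r, exists s, Q r -> sub r s.
  move=> [[a b] [c d]]; have [[/= ab cd Pr]|nQ] := pselect (Q (a, b, (c, d))).
    have [a' [b' [c' [d' [P' [aa' b'b] [cc' d'd] h k]]]]] :=
      step a b c d ab cd Pr.
    exists (a', b', (c', d')) => _; do !split => //=.
    - by rewrite -subr_ge0 h divr_ge0// subr_ge0.
    - by rewrite -subr_ge0 k divr_ge0// subr_ge0.
  by exists (a, b, (c, d)).
pose r n := iter n nxt (a0, b0, (c0, d0)).
have Qr n : Q (r n).
  elim: n => [|n IH]; first by split.
  by have [] := nxtP _ IH.
have subrn n : sub (r n) (r n.+1) by exact: nxtP.
have widthr n : (r n).1.2 - (r n).1.1 = (b0 - a0) / 2 ^+ n /\
               (r n).2.2 - (r n).2.1 = (d0 - c0) / 2 ^+ n.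
  elim: n => [|n [IH1 IH2]]; first by rewrite expr0 !divr1; split.
  have [_ _ _ -> ->] := subrn n.
  by rewrite IH1 IH2 exprSr invfM; split; rewrite mulrA mulrAC.
(* nested intervals: every lower end is below every upper end *)
have nested (l u : nat -> R) : (forall n, l n <= l n.+1) ->
    (forall n, u n.+1 <= u n) -> (forall n, l n <= u n) ->
    exists x, forall n, l n <= x <= u n.
  move=> l1 u1 lu.
  have lmono : {homo l : m n / (m <= n)%N >-> m <= n} by move/nondecreasing_seqP: l1.
  have umono : {homo u : m n / (m <= n)%N >-> n <= m}.
    by move/nonincreasing_seqP: u1.
  have lu' m n : l m <= u n.
    apply: le_trans (umono _ _ (leq_maxr m n)).
    exact: le_trans (lmono _ _ (leq_maxl m n)) _.
  exists (sup (range l)) => n; apply/andP; split.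
    apply: ub_le_sup; last by exists n.
    by exists (u 0%N) => _ [m _ <-].
  apply: ge_sup; first by exists (l 0%N), 0%N.
  by move=> _ [m _ <-].
have [x xP] := nested (fun n => (r n).1.1) (fun n => (r n).1.2)
  (fun n => let: And5 _ (conj h _) _ _ _ := subrn n in h)
  (fun n => let: And5 _ (conj _ h) _ _ _ := subrn n in h)
  (fun n => let: And3 h _ _ := Qr n in h).
have [y yP] := nested (fun n => (r n).2.1) (fun n => (r n).2.2)
  (fun n => let: And5 _ _ (conj h _) _ _ := subrn n in h)
  (fun n => let: And5 _ _ (conj _ h) _ _ := subrn n in h)
  (fun n => let: And3 _ h _ := Qr n in h).
exists x, y => e e0.
pose s := (b0 - a0) + (d0 - c0).
have s0 : 0 <= s by rewrite addr_ge0// subr_ge0.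
pose n := Num.trunc (s / e).
have pn : s < e * 2 ^+ n.+1.
  rewrite -ltr_pdivrMl// mulrC (lt_le_trans (truncnS_gt _))//.
  by rewrite -natrX ler_nat ltnW// ltn_expl.
have [w1 w2] := widthr n.+1; have [_ _ Pn] := Qr n.+1.
exists (r n.+1).1.1, (r n.+1).1.2, (r n.+1).2.1, (r n.+1).2.2.
have p2 : 0 < (2 : R) ^+ n.+1 by rewrite exprn_gt0.
split; [by []|exact: xP|exact: yP|rewrite w1|rewrite w2];
  rewrite ltr_pdivrMr//; apply: le_lt_trans pn; rewrite /s ?lerDl ?lerDr subr_ge0//.
Qed.

End Bisection.

Section SegmentIntegral.
Context {R : realType}.
Implicit Types (g : R -> R) (a b : R).

Definition segint g a b : R := \int[@lebesgue_measure R]_(x in `[a, b]) g x.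

Lemma integrable_segment g a b : continuous g ->
  (@lebesgue_measure R).-integrable `[a, b] (EFin \o g).
Proof.
move=> cg; apply: continuous_compact_integrable; first exact: segment_compact.
exact: continuous_subspaceT.
Qed.

Lemma segint_split g a m b : continuous g -> a <= m <= b ->
  segint g a b = segint g a m + segint g m b.
Proof.
move=> cg /andP[am mb]; rewrite /segint.
rewrite -(@Rintegral_itv_obnd_cbnd R m (BRight b) g); last first.
  apply: integrableS (integrable_segment m b cg) => //.
  exact: subset_itv_oc_cc.
rewrite -(@Rintegral_itvB R g (BLeft a) (BRight b) m) ?bnd_simp//.
  by rewrite addrC subrK.
exact: integrable_segment.
Qed.

Lemma segintB f g a b : continuous f -> continuous g ->
  segint (fun x => f x - g x) a b = segint f a b - segint g a b.
Proof. by move=> cf cg; rewrite /segint RintegralB//; exact: integrable_segment. Qed.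

Lemma segint_cst (k : R) a b : a <= b -> segint (fun=> k) a b = k * (b - a).
Proof.
move=> ab; rewrite /segint Rintegral_cst//= lebesgue_measure_itv/= lte_fin.
move: ab; rewrite le_eqVlt => /predU1P[->|ab]; first by rewrite ltxx subrr.
by rewrite ab.
Qed.

Lemma segint_near_cst g (k e : R) a b : continuous g -> a <= b ->
  (forall x, a <= x <= b -> `|g x - k| <= e) ->
  `|segint g a b - k * (b - a)| <= e * (b - a).
Proof.
move=> cg ab H; rewrite -!segint_cst// -segintB//; last by move=> ?; exact: cvg_cst.
have cg' : continuous (fun x => g x - k).
  by move=> x; apply: cvgB; [exact: cg|exact: cvg_cst].
apply: le_trans (le_normr_Rintegral _ (integrable_segment _ _ cg')) _ => //.
apply: le_Rintegral => //.
- by apply: integrable_segment => x; apply: cvg_norm; exact: cg'.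
- by apply: integrable_segment => x; exact: cvg_cst.
Qed.

End SegmentIntegral.

Section Goursat.
Context {R : realType}.
Implicit Types (f : R[i] -> R[i]) (a b c d : R).

Lemma entire_continuous f : entire f -> forall z e, 0 < e ->
  exists2 d : R, 0 < d & forall w, normc (w - z) < d -> normc (f w - f z) < e.
Proof.
move=> ef z e e0; have [l /(_ 1 ltr01)[d d0 H]] := entire_linear_approx ef z.
pose K := normc l + 1; have K0 : 0 < K by rewrite ltr_wpDl ?normc_ge0.
exists (Num.min d (e / K)) => [|w]; first by rewrite lt_min d0 divr_gt0.
rewrite lt_min => /andP[wd we]; have {}H := H w wd.
have -> : f w - f z = (f w - f z - l * (w - z)) + l * (w - z) by rewrite subrK.
apply: le_lt_trans (le_normcD _ _) _; rewrite normcM.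
rewrite ltr_pdivlMr// mulrDr mulr1 in we.
by move: H we; lra.
Qed.

Lemma complexReB (z w : R[i]) :
  complex.Re (z - w) = complex.Re z - complex.Re w.
Proof. by case: z w => a b []. Qed.

Lemma complexImB (z w : R[i]) :
  complex.Im (z - w) = complex.Im z - complex.Im w.
Proof. by case: z w => a b []. Qed.

Lemma entire_continuous_ReIm f : entire f ->
  continuous (fun p : R * R => complex.Re (f (p.1 +i* p.2))) /\
  continuous (fun p : R * R => complex.Im (f (p.1 +i* p.2))).
Proof.
move=> ef; suff near e p : 0 < e -> \forall q \near (p : R * R),
    normc (f (q.1 +i* q.2) - f (p.1 +i* p.2)) < e.
  split=> p; apply/cvgrPdist_lt => e e0; have := near e p e0;
    apply: filterS => q; rewrite distrC; apply: le_lt_trans.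
  - by rewrite -complexReB; exact: ler_Re_normc.
  - by rewrite -complexImB; exact: ler_Im_normc.
move=> e0; have [d d0 H] := entire_continuous ef (p.1 +i* p.2) e0.
have d20 : 0 < d / 2 by rewrite divr_gt0.
exists (ball p.1 (d / 2), ball p.2 (d / 2)) => /=.
  by split; exact: nbhsx_ballx.
move=> q [/= q1 q2]; apply: H; apply: le_lt_trans (normc_le_ReIm _) _ => /=.
move: q1 q2; rewrite /ball /= distrC => q1; rewrite distrC => q2; lra.
Qed.

Lemma entire_continuous_line f (x y h k : R) : entire f ->
  continuous (fun t => complex.Re (f ((x + h * t) +i* (y + k * t)))) /\
  continuous (fun t => complex.Im (f ((x + h * t) +i* (y + k * t)))).
Proof.
move=> /entire_continuous_ReIm[cR cI].
have aff (a b t : R) : a + b * s @[s --> t] --> a + b * t.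
  by apply: cvgD; [exact: cvg_cst|apply: cvgM; [exact: cvg_cst|exact: cvg_id]].
split=> t.
  exact: (cvg_comp2 (h := fun a b : R => complex.Re (f (a +i* b)))
    (aff x h t) (aff y k t) (cR (_, _))).
exact: (cvg_comp2 (h := fun a b : R => complex.Im (f (a +i* b)))
  (aff x h t) (aff y k t) (cI (_, _))).
Qed.

(** The real part of the vanishing of a contour integral over the boundary of a
    rectangle.  The boundary defect is additive under subdivision, so if it
    exceeds [K] times the squared half-perimeter, it does so for some quarter,
    and in the limit at a point.  There [f] is affine up to a relative error as
    small as desired, and affine functions have no defect.  The imaginary part
    is the same statement for [- 'i f]. *)
Lemma Goursat_rectangle f a b c d : entire f -> a <= b -> c <= d ->
  segint (fun x => complex.Re (f (x +i* c))) a b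
    - segint (fun x => complex.Re (f (x +i* d))) a b =
  segint (fun y => complex.Im (f (b +i* y))) c d
    - segint (fun y => complex.Im (f (a +i* y))) c d.
Proof.
move=> ef ab cd.
have cu y : continuous (fun x => complex.Re (f (x +i* y))).
  have [cR _] := entire_continuous_line 0 y 1 0 ef.
  rewrite (_ : (fun _ => _) = fun t => complex.Re (f ((0 + 1 * t) +i* (y + 0 * t)))) //.
  by apply/funext => t; rewrite add0r mul1r mul0r addr0.
have cv x : continuous (fun y => complex.Im (f (x +i* y))).
  have [_ cI] := entire_continuous_line x 0 0 1 ef.
  rewrite (_ : (fun _ => _) = fun t => complex.Im (f ((x + 0 * t) +i* (0 + 1 * t)))) //.
  by apply/funext => t; rewrite add0r mul1r mul0r addr0.
pose U a b y := segint (fun x => complex.Re (f (x +i* y))) a b.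
pose V c d x := segint (fun y => complex.Im (f (x +i* y))) c d.
pose B a b c d := U a b c - U a b d - (V c d b - V c d a).
apply/eqP; rewrite -subr_eq0 -normr_le0 -/(U a b c) -/(U a b d) -/(V c d b)
  -/(V c d a) -/(B a b c d).
suff small K : 0 < K -> `|B a b c d| <= K * ((b - a) + (d - c)) ^+ 2.
  apply/ler_addgt0Pl => e e0; rewrite addr0.
  have s0 : 0 < ((b - a) + (d - c)) ^+ 2 + 1 by rewrite ltr_wpDl ?sqr_ge0.
  apply: le_trans (small _ (divr_gt0 e0 s0)) _.
  by rewrite mulrAC ler_pdivrMr// ler_pM2l// lerDl.
move=> K0; rewrite leNgt; apply/negP => PB.
pose P a b c d := K * ((b - a) + (d - c)) ^+ 2 < `|B a b c d|.
have [|x [y xy]] := @bisection R P _ a b c d ab cd PB.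
  move=> {PB}a {}b {}c {}d {}ab {}cd PB.
  pose m := (a + b) / 2; pose m' := (c + d) / 2.
  have am : a <= m <= b by rewrite /m; lra.
  have cm : c <= m' <= d by rewrite /m'; lra.
  have BE : B a b c d = B a m c m' + B m b c m' + B a m m' d + B m b m' d.
    rewrite /B /U /V (segint_split (cu c) am) (segint_split (cu d) am)
      (segint_split (cv a) cm) (segint_split (cv b) cm); lra.
  have [|H1] := ltP (K * ((m - a) + (m' - c)) ^+ 2) `|B a m c m'|.
    by exists a, m, c, m'; split; rewrite /m /m' //; lra.
  have [|H2] := ltP (K * ((b - m) + (m' - c)) ^+ 2) `|B m b c m'|.
    by exists m, b, c, m'; split; rewrite /m /m' //; lra.
  have [|H3] := ltP (K * ((m - a) + (d - m')) ^+ 2) `|B a m m' d|.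
    by exists a, m, m', d; split; rewrite /m /m' //; lra.
  have [|H4] := ltP (K * ((b - m) + (d - m')) ^+ 2) `|B m b m' d|.
    by exists m, b, m', d; split; rewrite /m /m' //; lra.
  have := ler_normD (B a m c m' + B m b c m' + B a m m' d) (B m b m' d).
  have := ler_normD (B a m c m' + B m b c m') (B a m m' d).
  have := ler_normD (B a m c m') (B m b c m').
  move: PB; rewrite /P BE.
  have e1 : (m - a) + (m' - c) = ((b - a) + (d - c)) / 2 by rewrite /m /m'; lra.
  have e2 : (b - m) + (m' - c) = ((b - a) + (d - c)) / 2 by rewrite /m /m'; lra.
  have e3 : (m - a) + (d - m') = ((b - a) + (d - c)) / 2 by rewrite /m /m'; lra.
  have e4 : (b - m) + (d - m') = ((b - a) + (d - c)) / 2 by rewrite /m /m'; lra.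
  rewrite e1 in H1; rewrite e2 in H2; rewrite e3 in H3; rewrite e4 in H4.
  rewrite !expr_div_n in H1 H2 H3 H4.
  lra.
(* near the limit point, [f] is affine up to a relative error [K / 4] *)
have K30 : 0 < K / 4 by rewrite divr_gt0.
have [[p q] /(_ _ K30)[e e0 H]] := entire_linear_approx ef (x +i* y).
have e20 : 0 < e / 2 by rewrite divr_gt0.
have {xy ab cd PB}[a' [b' [c' [d' [PB /andP[ax xb] /andP[cy yd] we he]]]]] := xy _ e20.
set s := (b' - a') + (d' - c') in PB *.
have near w1 w2 : a' <= w1 <= b' -> c' <= w2 <= d' ->
   normc (f (w1 +i* w2) - f (x +i* y) - (p +i* q) * ((w1 +i* w2) - (x +i* y)))
    <= K / 4 * s.
  move=> /andP[aw wb] /andP[cw wd].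
  have n : normc ((w1 +i* w2) - (x +i* y)) <= s.
    apply: le_trans (normc_le_ReIm _) _ => /=.
    by apply: lerD; rewrite ler_norml; lra.
  apply: le_trans (H _ _) _; last by rewrite ler_wpM2l// ltW.
  apply: le_lt_trans (normc_le_ReIm _) _ => /=.
  rewrite [ltRHS](splitr e); apply: ltrD; rewrite ltr_norml; lra.
have Re_near w1 w2 : a' <= w1 <= b' -> c' <= w2 <= d' ->
  `|complex.Re (f (w1 +i* w2)) - complex.Re (f (x +i* y))
    - (p * (w1 - x) - q * (w2 - y))| <= K / 4 * s.
  move=> h1 h2; apply: le_trans (near _ _ h1 h2).
  by apply: le_trans (ler_Re_normc _); rewrite !complexReB.
have Im_near w1 w2 : a' <= w1 <= b' -> c' <= w2 <= d' ->
  `|complex.Im (f (w1 +i* w2)) - complex.Im (f (x +i* y))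
    - (p * (w2 - y) + q * (w1 - x))| <= K / 4 * s.
  move=> h1 h2; apply: le_trans (near _ _ h1 h2).
  by apply: le_trans (ler_Im_normc _); rewrite !complexImB.
have ab : a' <= b' by lra.
have cd : c' <= d' by lra.
have ca : a' <= a' <= b' by rewrite lexx.
have cb : a' <= b' <= b' by rewrite lexx ab.
have cc : c' <= c' <= d' by rewrite lexx.
have cd' : c' <= d' <= d' by rewrite lexx cd.
have EU : `|U a' b' c' - U a' b' d' - q * (d' - c') * (b' - a')| <=
    K / 2 * s * (b' - a').
  rewrite /U -segintB//; apply: segint_near_cst => //.
    by move=> t; apply: cvgB; exact: cu.
  move=> t tab; have := Re_near t c' tab cc; have := Re_near t d' tab cd'.
  rewrite !ler_norml => /andP[h1 h2] /andP[h3 h4]; apply/andP; split; lra.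
have EV : `|V c' d' b' - V c' d' a' - q * (b' - a') * (d' - c')| <=
    K / 2 * s * (d' - c').
  rewrite /V -segintB//; apply: segint_near_cst => //.
    by move=> t; apply: cvgB; exact: cv.
  move=> t tcd; have := Im_near a' t ca tcd; have := Im_near b' t cb tcd.
  rewrite !ler_norml => /andP[h1 h2] /andP[h3 h4]; apply/andP; split; lra.
have : `|B a' b' c' d'| <= K / 2 * s ^+ 2.
  have -> : K / 2 * s ^+ 2 = K / 2 * s * (b' - a') + K / 2 * s * (d' - c').
    by rewrite -mulrDr -/s expr2 mulrA.
  move: EU EV; rewrite /B !ler_norml => /andP[h1 h2] /andP[h3 h4].
  by apply/andP; split; lra.
have s2 : 0 <= K * s ^+ 2 by rewrite mulr_ge0 ?sqr_ge0// ltW.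
move: PB; rewrite /P -/s; lra.
Qed.

(** The function [z |-> 'i f (exp z)] has period [2 pi i], so the horizontal
    sides of the rectangle cancel; what remains compares two circle means. *)
Lemma circle_mean_const f (s t : R) : entire f -> s <= t ->
  segint (fun y => complex.Re (f (cexp (s +i* y)))) 0 (pi *+ 2) =
  segint (fun y => complex.Re (f (cexp (t +i* y)))) 0 (pi *+ 2).
Proof.
move=> ef st; have pi20 : 0 <= pi *+ 2 :> R by rewrite mulrn_wge0// pi_ge0.
have eF : entire (fun z => 'i%C * f (cexp z)).
  apply: (entireM (f := fun=> 'i%C)); first exact: entire_cst.
  exact: entire_comp ef entire_cexp.
have ImM (z : R[i]) : complex.Im ('i%C * z) = complex.Re z.
  by rewrite mulrC ImiRe.
have := Goursat_rectangle eF st pi20.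
have per x : cexp (x +i* (pi *+ 2)) = cexp (x +i* 0) :> R[i].
  by rewrite /cexp /= cos2pi sin2pi cos0 sin0.
under [X in X - _]eq_Rintegral do rewrite -per.
rewrite subrr => /esym/eqP; rewrite subr_eq0 => /eqP.
rewrite /segint.
under eq_Rintegral do rewrite ImM.
by under [RHS]eq_Rintegral do rewrite ImM.
Qed.

(** The circle of radius [exp s] shrinks to the origin as [s] decreases, where
    continuity of [f] gives the common value of the means. *)
Lemma circle_mean f : entire f ->
  segint (fun y => complex.Re (f (cos y +i* sin y))) 0 (pi *+ 2) =
  complex.Re (f 0) * (pi *+ 2).
Proof.
move=> ef; have pi20 : 0 < pi *+ 2 :> R by rewrite mulrn_wgt0// pi_gt0.
have -> : segint (fun y => complex.Re (f (cos y +i* sin y))) 0 (pi *+ 2) =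
    segint (fun y => complex.Re (f (cexp (0 +i* y)))) 0 (pi *+ 2).
  by apply: eq_Rintegral => y _; rewrite /cexp /= expR0 !mul1r.
apply/eqP; rewrite -subr_eq0 -normr_le0.
apply/ler_addgt0Pl => e e0; rewrite addr0.
have [d d0 H] := entire_continuous ef 0 (divr_gt0 e0 pi20).
pose s := Num.min 0 (ln (d / 2)).
have sd : expR s < d.
  apply: (@le_lt_trans _ _ (d / 2)); last by rewrite gtr_pMr// invf_lt1// ltr1n.
  by rewrite -[leRHS]lnK ?posrE ?divr_gt0// ler_expR ge_min lexx orbT.
rewrite -(circle_mean_const ef (_ : s <= 0)) ?ge_min ?lexx//.
apply: (@le_trans _ _ (e / (pi *+ 2) * (pi *+ 2 - 0))); last first.
  by rewrite subr0 divfK// gt_eqF.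
rewrite -{2}(subr0 (pi *+ 2)); apply: segint_near_cst (ltW pi20) _.
  have [cR _] := entire_continuous_line s 0 0 1 (entire_comp ef entire_cexp).
  rewrite (_ : (fun _ => _) = fun t =>
    complex.Re (f (cexp ((s + 0 * t) +i* (0 + 1 * t))))) //.
  by apply/funext => t; rewrite mul0r add0r mul1r addr0.
move=> y _; rewrite -complexReB; apply: le_trans (ler_Re_normc _) (ltW _).
by apply: H; rewrite subr0 normc_cexp.
Qed.

End Goursat.

(** * Area-preserving maps of the plane *)
Section PlaneMeasure.
Context {R : realType}.
Local Notation mu := (@lebesgue_measure R).
Local Notation line := (measurableTypeR R).
Local Notation plane := (measurableTypeR R * measurableTypeR R)%type.
Local Notation mu2 := (mu \x mu)%E.

(** An open set is the union of the squares with rational centre and half-side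
    that it contains. *)
Lemma open_measurable_plane (A : set (R * R)) :
  open A -> measurable (A : set plane).
Proof.
move=> oA.
pose box (k : rat * rat * rat) : set (R * R) :=
  [set` `](ratr k.1.1 - ratr k.2), (ratr k.1.1 + ratr k.2)[%R] `*`
  [set` `](ratr k.1.2 - ratr k.2), (ratr k.1.2 + ratr k.2)[%R].
pose F k : set plane := if pselect (box k `<=` A) then box k else set0.
have -> : A = \bigcup_k F k.
  apply/seteqP; split => [[x y] Axy|xy [k _]]; last first.
    by rewrite /F; case: pselect => // kA /kA.
  have /nbhs_ballP[e /= e0 eA] : nbhs (x, y) A by exact: oA.
  have e42 : e / 4 < e / 2 by lra.
  have [r] := rat_in_itvoo e42; rewrite in_itv/= => /andP[r4 r2].
  have near_rat (t : R) : exists q : rat, `|ratr q - t| < e / 4.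
    have te : t - e / 4 < t + e / 4 by lra.
    have [q] := rat_in_itvoo te; rewrite in_itv/= => /andP[q1 q2].
    by exists q; rewrite ltr_norml; lra.
  have [p] := near_rat x; have [q] := near_rat y.
  rewrite !ltr_norml => /andP[q1 q2] /andP[p1 p2].
  exists (p, q, r) => //; rewrite /F; case: pselect => [?|[]] /=.
    by split => /=; rewrite in_itv/=; apply/andP; split; lra.
  move=> [u v] [/=]; rewrite !in_itv/= => /andP[u1 u2] /andP[v1 v2].
  by apply: eA; split; rewrite /= /ball /= ltr_norml; lra.
apply: countable_bigcupT_measurable => // k; rewrite /F.
case: pselect => ? /=; last exact: measurable0.
by apply: (@measurableX _ _ line line); exact: measurable_itv.
Qed.

Lemma measurable_continuous_plane (f : R * R -> R) :
  continuous f -> measurable_fun [set: plane] (f : plane -> line).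
Proof.
move=> /continuousP cf;
apply: (measurability _ (measurable_realfun.RGenOpens.measurableE R)).
move=> _ [_ [a [b ->] <-]]; rewrite setTI; apply: open_measurable_plane.
exact/cf/interval_open.
Qed.

Lemma lebesgue_measure_shift (t : R) (A : set line) :
  measurable A -> mu ((fun y : line => y + t : line) @^-1` A) = mu A.
Proof.
have ms : measurable_fun [set: line] (fun y : line => y + t : line).
  exact: measurable_funD.
move=> mA; symmetry; rewrite -/(pushforward mu (fun y : line => y + t : line) A).
apply: lebesgue_measure_unique => //= _ [[a b]] _ <-.
have pre : (fun y : line => y + t : line) @^-1` `]a, b]%classic =
    `](a - t), (b - t)]%classic.
  by apply/seteqP; split => y; rewrite /= !in_itv/= ltrBlDr lerBrDr.
rewrite /pushforward pre !lebesgue_measure_itv/= !lte_fin ltrD2r.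
by case: ifP => // _; rewrite -!EFinB opprB addrA subrK.
Qed.

Definition area_preserving (T : plane -> plane) :=
  measurable_fun [set: plane] T /\
  forall A, measurable A -> mu2 (T @^-1` A) = mu2 A.

Lemma area_preserving_comp S T :
  area_preserving S -> area_preserving T -> area_preserving (S \o T).
Proof.
move=> [mS pS] [mT pT]; split; first exact: measurableT_comp.
move=> A mA; rewrite comp_preimage pT ?pS//.
by rewrite -[X in measurable X]setTI; exact: mS.
Qed.

(** A shear translates each vertical section, hence keeps its length; the area
    is the integral of these lengths. *)
Lemma area_preserving_shear_y (c : line -> line) : measurable_fun setT c ->
  area_preserving (fun p => (p.1, p.2 + c p.1)).
Proof.
move=> mc; split.
  apply/measurable_fun_pairP; split; first exact: measurable_fst.
  apply: measurable_funD; first exact: measurable_snd.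
  exact: measurableT_comp.
move=> A mA; rewrite /product_measure1; apply: eq_integral => x _ /=.
rewrite -[RHS](lebesgue_measure_shift (c x)); last exact: measurable_xsection.
by congr (mu _); apply/seteqP; split => y; rewrite /= /xsection /= !inE.
Qed.

Lemma product_measure12 (A : set plane) :
  measurable A -> mu2 A = (mu \x^ mu)%E A.
Proof. by apply: product_measure_unique => B C mB mC; exact: product_measure2E. Qed.

Lemma area_preserving_shear_x (c : line -> line) : measurable_fun setT c ->
  area_preserving (fun p => (p.1 + c p.2, p.2)).
Proof.
move=> mc; have mT : measurable_fun [set: plane]
    ((fun p => (p.1 + c p.2, p.2)) : plane -> plane).
  apply/measurable_fun_pairP; split; last exact: measurable_snd.
  apply: measurable_funD; first exact: measurable_fst.
  exact: measurableT_comp.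
split=> // A mA; rewrite !product_measure12//; last first.
  by rewrite -[X in measurable X]setTI; exact: mT.
rewrite /product_measure2; apply: eq_integral => y _ /=.
rewrite -[RHS](lebesgue_measure_shift (c y)); last exact: measurable_ysection.
by congr (mu _); apply/seteqP; split => x; rewrite /= /ysection /= !inE.
Qed.

Lemma area_preserving_translation (a b : R) :
  area_preserving (fun p => (p.1 + a, p.2 + b)).
Proof.
have := area_preserving_comp (area_preserving_shear_x (measurable_cst a))
  (area_preserving_shear_y (measurable_cst b)).
exact.
Qed.

(** Three shears compose to the rotation with matrix [(c, -s; s, c)] unless
    [c = -1]; the half-turn is the square of a quarter-turn. *)
Lemma area_preserving_rotation (c s : R) : c ^+ 2 + s ^+ 2 = 1 ->
  area_preserving (fun p => (c * p.1 - s * p.2, s * p.1 + c * p.2)).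
Proof.
have lin (k : R) : measurable_fun [set: line] (fun t : line => k * t : line).
  exact: measurable_funM.
have main c' s' : c' != -1 -> c' ^+ 2 + s' ^+ 2 = 1 ->
    area_preserving (fun p => (c' * p.1 - s' * p.2, s' * p.1 + c' * p.2)).
  move: c' s' => {}c {}s c1 cs; pose a := - s / (1 + c).
  have c10 : 1 + c != 0 by rewrite addrC addr_eq0.
  have := area_preserving_comp (area_preserving_shear_x (lin a))
    (area_preserving_comp (area_preserving_shear_y (lin s))
       (area_preserving_shear_x (lin a))).
  congr area_preserving; apply/funext => -[x y] /=.
  have as_ : s * a = c - 1.
    apply: (mulIf c10); rewrite /a mulrA divfK//.
    rewrite mulrN -expr2; lra.
  have ac : a * (1 + c) = - s by rewrite /a divfK.
  have -> : x + a * y + a * (y + s * (x + a * y))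
    = (1 + s * a) * x + (1 + (1 + s * a)) * a * y by ring.
  have -> : y + s * (x + a * y) = s * x + (1 + s * a) * y by ring.
  have -> : 1 + s * a = c by rewrite as_ addrC subrK.
  by rewrite [_ * a]mulrC ac mulNr.
move=> cs; have [c1|] := eqVneq c (-1); last by move/main; exact.
have s0 : s = 0.
  by apply/eqP; rewrite -sqrf_eq0; apply/eqP; move: cs; rewrite c1; lra.
have r : area_preserving (fun p => (0 * p.1 - 1 * p.2, 1 * p.1 + 0 * p.2)).
  by apply: main; rewrite ?expr0n ?expr1n ?add0r// eq_sym oppr_eq0 oner_eq0.
have := area_preserving_comp r r; congr area_preserving.
apply/funext => -[x y] /=; rewrite c1 s0; congr pair; ring.
Qed.

Lemma integral_area_preserving_ge0 T (f : plane -> \bar R) :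
  area_preserving T -> measurable_fun setT f -> (forall p, 0 <= f p)%E ->
  (\int[mu2]_p f (T p) = \int[mu2]_p f p)%E.
Proof.
move=> [mT pT] mf f0.
have := @ge0_integral_pushforward _ _ plane plane R T mT mu2 setT f measurableT mf
  (fun p _ => f0 p).
rewrite preimage_setT => <-.
by apply: eq_measure_integral => //= A mA _; exact: pT.
Qed.

Lemma integrable_area_preserving T (f : plane -> \bar R) :
  area_preserving T -> mu2.-integrable setT f ->
  mu2.-integrable setT (fun p => f (T p)).
Proof.
move=> aT /integrableP[mf fi]; apply/integrableP; split.
  by apply: measurableT_comp => //; case: aT.
rewrite (integral_area_preserving_ge0 (f := fun p => `|f p|%E))//.
exact: measurableT_comp.
Qed.

Lemma integral_area_preserving T (f : plane -> \bar R) :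
  area_preserving T -> mu2.-integrable setT f ->
  (\int[mu2]_p f (T p) = \int[mu2]_p f p)%E.
Proof.
move=> aT fi; have fTi := integrable_area_preserving aT fi.
have mf := measurable_int _ fi; case: aT => mT pT.
have := @integral_pushforward _ _ plane plane R T mT mu2 setT f mf fTi measurableT.
rewrite preimage_setT => <-.
by apply: eq_measure_integral => //= A mA _; exact: pT.
Qed.

End PlaneMeasure.

(** * The Gaussian mean value property *)
Section GaussianMean.
Context {R : realType}.
Local Notation mu := (@lebesgue_measure R).
Local Notation line := (measurableTypeR R).
Local Notation plane := (measurableTypeR R * measurableTypeR R)%type.
Local Notation mu2 := (mu \x mu)%E.

(** The area measure under a name of its own, to carry the sigma-finiteness that
    Fubini requires of the second factor when an angle is the first one. *)
Definition plane_measure : set plane -> \bar R := mu2.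
HB.instance Definition _ := Measure.on plane_measure.

Lemma plane_sigma_finite : sigma_finite setT plane_measure.
Proof.
have /sigma_finiteP[F [TF ndF Foo]] := sigma_finiteT mu.
exists (fun n => F n `*` F n).
  apply/seteqP; split => // -[x y] _.
  have [m _ Fx] : (\bigcup_i F i) x by rewrite -TF.
  have [n _ Fy] : (\bigcup_i F i) y by rewrite -TF.
  exists (maxn m n) => //; split => /=.
  - by move: x Fx; exact/subsetPset/ndF/leq_maxl.
  - by move: y Fy; exact/subsetPset/ndF/leq_maxr.
move=> n; have [mF Fn] := Foo n; split; first exact: measurableX.
by rewrite /plane_measure product_measure1E// lte_mul_pinfty// ge0_fin_numE.
Qed.

HB.instance Definition _ :=
  Measure_isSigmaFinite.Build _ _ _ plane_measure plane_sigma_finite.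

Definition gauss2 (p : plane) : R := expR (- normc (p.1 +i* p.2) ^+ 2).

Lemma gauss2E p : gauss2 p = gauss_fun p.1 * gauss_fun p.2.
Proof. by rewrite /gauss2 sqr_normc_ReIm /= opprD expRD. Qed.

Lemma measurable_gauss2 : measurable_fun [set: plane] (gauss2 : plane -> line).
Proof.
rewrite (_ : gauss2 = fun p => gauss_fun p.1 * gauss_fun p.2); last first.
  by apply/funext => p; rewrite gauss2E.
by apply: measurable_funM; apply: measurableT_comp => //;
  exact: measurable_gauss_fun.
Qed.

Lemma integral_gauss2 : (\int[mu2]_p (gauss2 p)%:E = pi%:E)%E.
Proof.
rewrite fubini_tonelli1 /fubini_F; [|by apply/measurable_EFinP; exact: measurable_gauss2|
  by move=> p; rewrite lee_fin expR_ge0].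
transitivity (\int[mu]_x ((gauss_fun x)%:E * (Num.sqrt pi)%:E))%E.
  apply: eq_integral => x _.
  rewrite -integralT_gauss -ge0_integralZl//=.
  - by apply: eq_integral => y _; rewrite gauss2E EFinM.
  - by apply/measurable_EFinP; exact: measurable_gauss_fun.
  - by move=> y _; rewrite lee_fin gauss_fun_ge0.
  - by rewrite lee_fin gauss_fun_ge0.
rewrite ge0_integralZr//=.
- by rewrite integralT_gauss -EFinM -expr2 sqr_sqrtr// pi_ge0.
- by apply/measurable_EFinP; exact: measurable_gauss_fun.
- by move=> y _; rewrite lee_fin gauss_fun_ge0.
Qed.

Lemma integrable_gauss2 : mu2.-integrable setT (fun p => (gauss2 p)%:E).
Proof.
apply/integrableP; split; first by apply/measurable_EFinP; exact: measurable_gauss2.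
under eq_integral do rewrite gee0_abs ?lee_fin ?expR_ge0//.
by rewrite integral_gauss2 ltry.
Qed.

Lemma gauss2_rotation (t : R) (p : plane) :
  gauss2 (cos t * p.1 - sin t * p.2, sin t * p.1 + cos t * p.2) = gauss2 p.
Proof.
rewrite /gauss2 !sqr_normc_ReIm /=; congr (expR (- _)).
have -> : (cos t * p.1 - sin t * p.2) ^+ 2 + (sin t * p.1 + cos t * p.2) ^+ 2
  = (cos t ^+ 2 + sin t ^+ 2) * (p.1 ^+ 2 + p.2 ^+ 2) by ring.
by rewrite cos2Dsin2 mul1r.
Qed.

Lemma integral_indicM_segment (g : R -> R) : continuous g ->
  (\int[mu]_t (\1_(`[0%R, (pi *+ 2)%R]%classic) t * g t)%:E =
   (segint g 0 (pi *+ 2))%:E)%E.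
Proof.
move=> cg; rewrite /segint /Rintegral fineK; last first.
  by apply: integrable_fin_num => //; exact: integrable_segment.
rewrite [RHS]integral_mkcond; apply: eq_integral => t _.
by rewrite patchE indicE; case: ifP => _; rewrite ?mul1r ?mul0r.
Qed.

(** Fubini for [(t, p) |-> Re (f (exp (i t) p)) exp (- |p|^2)] over
    [[0, 2 pi] x R^2]: integrating first in [p] gives [2 pi] times the left-hand
    side by rotation invariance, integrating first in [t] gives circle means. *)
Lemma gaussian_mean (f : R[i] -> R[i]) : entire f ->
  mu2.-integrable setT (fun p => (complex.Re (f (p.1 +i* p.2)) * gauss2 p)%:E) ->
  (\int[mu2]_p (complex.Re (f (p.1 +i* p.2)) * gauss2 p)%:E =
   (complex.Re (f 0%R) * pi)%:E)%E.
Proof.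
move=> ef; set F := fun p : plane => _; move=> iF.
have FE p : F p = (complex.Re (f (p.1 +i* p.2)) * gauss2 p)%:E by [].
clearbody F.
have pi2_gt0 : 0 < pi *+ 2 :> R by rewrite mulrn_wgt0// pi_gt0.
pose D : set line := `[0, pi *+ 2]%classic.
have mD : measurable D by exact: measurable_itv.
pose I : line -> R := \1_D.
pose rot (t : line) (p : plane) : plane :=
  (cos t * p.1 - sin t * p.2, sin t * p.1 + cos t * p.2).
pose Psi (q : line * plane) : \bar R := ((I q.1)%:E * F (rot q.1 q.2))%E.
have arot t : area_preserving (rot t).
  by apply: area_preserving_rotation; exact: cos2Dsin2.
have mI : measurable_fun [set: line] (EFin \o I).
  by apply/measurable_EFinP; exact: measurable_indic.
have mPsi : measurable_fun setT Psi.
  have mcos : measurable_fun [set: line] (cos : line -> line).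
    by apply: continuous_measurable_fun; exact: continuous_cos.
  have msin : measurable_fun [set: line] (sin : line -> line).
    by apply: continuous_measurable_fun; exact: continuous_sin.
  apply: emeasurable_funM.
    apply: (measurableT_comp (f := EFin \o I)) => //.
  apply: (measurableT_comp (f := F)); first exact: measurable_int iF.
  apply/measurable_fun_pairP; split.
    apply: measurable_funB; apply: measurable_funM => /=;
      repeat apply: measurableT_comp => //.
  apply: measurable_funD; apply: measurable_funM => /=;
      repeat apply: measurableT_comp => //.
have IF : (\int[mu]_t (I t)%:E = (pi *+ 2)%:E)%E.
  rewrite integral_indic// setIT.
  have := lebesgue_measure_itv `[0%R, (pi *+ 2 : R)%R].
  by rewrite /= lte_fin pi2_gt0 -EFinB subr0.
have I0 t : (0 <= (I t)%:E)%E by rewrite lee_fin.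
have PsiE t p : Psi (t, p) = ((I t)%:E * F (rot t p))%E by [].
have bound : (\int[mu]_t \int[mu2]_p `|Psi (t, p)| < +oo)%E.
  have -> : (\int[mu]_t \int[mu2]_p `|Psi (t, p)| =
    \int[mu]_t ((I t)%:E * \int[mu2]_p `|F p|))%E.
    apply: eq_integral => t _.
    under eq_integral do rewrite PsiE abseM gee0_abs//.
    rewrite ge0_integralZl//; last first.
      apply: measurableT_comp => //; apply: measurableT_comp.
        exact: measurable_int iF.
      by case: (arot t).
    congr (_ * _)%E.
    apply: (integral_area_preserving_ge0 (f := fun p => `|F p|%E)) => //.
    by apply: measurableT_comp => //; exact: measurable_int iF.
  rewrite ge0_integralZr// ?integral_ge0// IF.
  by apply: lte_mul_pinfty; rewrite ?lee_fin ?ltW//; case/integrableP: iF.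
have iPsi :=
  iffRL (@integrable12ltyP _ _ line plane R mu plane_measure Psi mPsi) bound.
have iI : mu.-integrable setT (EFin \o I).
  apply/integrableP; split => //.
  rewrite (eq_integral (fun t => (I t)%:E)) ?IF ?ltry// => t _.
  exact: gee0_abs (I0 t).
have : (\int[mu]_t \int[mu2]_p ((I t)%:E * F (rot t p)) =
        \int[mu2]_p \int[mu]_t ((I t)%:E * F (rot t p)))%E := Fubini iPsi.
have -> : (\int[mu]_t \int[mu2]_p ((I t)%:E * F (rot t p)) =
    (pi *+ 2)%:E * \int[mu2]_p F p)%E.
  have Cfin : (\int[mu2]_p F p)%E \is a fin_num by exact: integrable_fin_num.
  rewrite -IF -(fineK Cfin) -integralZr//; apply: eq_integral => t _.
  rewrite integralZl//; last exact: integrable_area_preserving.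
  by rewrite fineK// (integral_area_preserving (arot t)).
have -> : (\int[mu2]_p \int[mu]_t ((I t)%:E * F (rot t p)) =
    \int[mu2]_p ((complex.Re (f 0%R) * (pi *+ 2))%:E * (gauss2 p)%:E))%E.
  apply: eq_integral => p _.
  pose fp z := f ((p.1 +i* p.2) * z) * (gauss2 p)%:C.
  have efp : entire fp.
    apply: entireM; last exact: entire_cst.
    apply: (entire_comp ef); apply: (entireM (f := fun=> _)); first exact: entire_cst.
    exact: entire_id.
  have ReC (z : R[i]) (k : R) : complex.Re (z * k%:C) = complex.Re z * k.
    by case: z => a b /=; rewrite mulr0 subr0.
  transitivity (\int[mu]_t (I t * complex.Re (fp (cos t +i* sin t)))%:E)%E.
    apply: eq_integral => t _; rewrite FE /= gauss2_rotation -EFinM /fp ReC.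
    have -> // : (p.1 +i* p.2) * (cos t +i* sin t) =
      (cos t * p.1 - sin t * p.2) +i* (sin t * p.1 + cos t * p.2).
    by apply/eqP; rewrite eq_complex /=; apply/andP; split; apply/eqP; ring.
  rewrite integral_indicM_segment ?circle_mean//.
    by rewrite /fp mulr0 ReC mulrAC EFinM.
  have [cR _] := entire_continuous_ReIm efp.
  have ccos (t : R) : cos s @[s --> t] --> cos t by exact: continuous_cos.
  have csin (t : R) : sin s @[s --> t] --> sin t by exact: continuous_sin.
  by move=> t; exact: (cvg_comp2 (h := fun a b : R => complex.Re (fp (a +i* b)))
    (ccos t) (csin t) (cR (_, _))).
rewrite integralZl//; last exact: integrable_gauss2.
rewrite integral_gauss2 -EFinM => H.
have Cfin : (\int[mu2]_p F p)%E \is a fin_num by exact: integrable_fin_num.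
move: H; rewrite -(fineK Cfin) -EFinM => -[H]; congr EFin.
apply: (mulfI (lt0r_neq0 pi2_gt0)); rewrite H; ring.
Qed.

End GaussianMean.

(** * The real inner product of the Fock space and its reproducing kernel *)
Section FockInnerProduct.
Context {R : realType}.
Implicit Types (f g k : R[i] -> R[i]) (z w c : R[i]).
Local Notation mu := (@lebesgue_measure R).
Local Notation line := (measurableTypeR R).
Local Notation plane := (measurableTypeR R * measurableTypeR R)%type.
Local Notation mu2 := (mu \x mu)%E.

(** The density of the real inner product [Re <f, g>], up to the factor
    [1 / pi]. *)
Definition wprod f g (p : plane) : R :=
  complex.Re (f (p.1 +i* p.2) * (g (p.1 +i* p.2))^*%C) * gauss2 p.

Definition fock_ip f g : R := pi^-1 * \int[mu2]_p wprod f g p.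

Lemma complexReJ z w : complex.Re (z * w^*%C) =
  complex.Re z * complex.Re w + complex.Im z * complex.Im w.
Proof. by case: z w => a b [c d] /=; rewrite mulrN opprK. Qed.

Lemma complexRe_mulr z (t : R) : complex.Re (z * t%:C) = complex.Re z * t.
Proof. by case: z => a b /=; rewrite mulr0 subr0. Qed.

Lemma sqr_normcE z : normc z ^+ 2 = complex.Re (z * z^*%C).
Proof. by rewrite sqr_normc_ReIm complexReJ -!expr2. Qed.

Lemma measurable_wprod f g : entire f -> entire g ->
  measurable_fun setT (wprod f g : plane -> line).
Proof.
move=> /entire_continuous_ReIm[fR fI] /entire_continuous_ReIm[gR gI].
apply: measurable_funM; last exact: measurable_gauss2.
rewrite (_ : (fun _ => _) = fun p : plane =>
    complex.Re (f (p.1 +i* p.2)) * complex.Re (g (p.1 +i* p.2)) +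
    complex.Im (f (p.1 +i* p.2)) * complex.Im (g (p.1 +i* p.2))); last first.
  by apply/funext => p; rewrite complexReJ.
by apply: measurable_funD; apply: measurable_funM;
  exact: measurable_continuous_plane.
Qed.

Lemma wprod_self_ge0 f p : 0 <= wprod f f p.
Proof. by rewrite mulr_ge0 ?expR_ge0// -sqr_normcE sqr_ge0. Qed.

Lemma fock_normsqE f :
  (fock_normsq f = pi^-1%:E * \int[mu2]_p (wprod f f p)%:E)%E.
Proof.
rewrite /fock_normsq; congr (_ * _)%E; apply: eq_integral => p _.
by rewrite /wprod -sqr_normcE.
Qed.

Lemma fockP f : fock f <->
  entire f /\ mu2.-integrable setT (fun p => (wprod f f p)%:E).
Proof.
have i0 : (0 <= \int[mu2]_p (wprod f f p)%:E)%E.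
  by apply: integral_ge0 => p _; rewrite lee_fin wprod_self_ge0.
have absE : (\int[mu2]_p `|(wprod f f p)%:E| = \int[mu2]_p (wprod f f p)%:E)%E.
  by apply: eq_integral => p _; rewrite gee0_abs// lee_fin wprod_self_ge0.
have pi1 : 0 < pi^-1 :> R by rewrite invr_gt0 pi_gt0.
split=> [[ef]|[ef /integrableP[_]]]; rewrite ?absE => H; split => //.
  apply/integrableP; split.
    by apply/measurable_EFinP; exact: measurable_wprod.
  move: H; rewrite fock_normsqE absE.
  case: (\int[mu2]_p _)%E i0 => [r _ _|_|//]; first exact: ltry.
  by rewrite mulry gtr0_sg// mul1e.
rewrite fock_normsqE; case: (\int[mu2]_p _)%E H => [r _|//|//].
  by rewrite -EFinM ltry.
by rewrite mulrNy gtr0_sg// mul1e.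
Qed.

Lemma fine_fock_normsq f : fock f -> fine (fock_normsq f) = fock_ip f f.
Proof.
move=> /fockP[_ fi]; rewrite fock_normsqE fineM//.
exact: integrable_fin_num.
Qed.

Lemma wprod_le f g p : `|wprod f g p| <= wprod f f p + wprod g g p.
Proof.
rewrite /wprod normrM (ger0_norm (expR_ge0 _)) -mulrDl ler_wpM2r ?expR_ge0//.
rewrite !complexReJ; set a := complex.Re _; set b := complex.Re _.
set c := complex.Im _; set d := complex.Im _.
have sq (x y : R) : 0 <= (x + y) ^+ 2 by exact: sqr_ge0.
rewrite ler_norml; apply/andP; split.
  have := sq a b; have := sq c d; have := sq a 0; have := sq b 0.
  have := sq c 0; have := sq d 0; nra.
have := sq a (- b); have := sq c (- d); have := sq a 0; have := sq b 0.
have := sq c 0; have := sq d 0; nra.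
Qed.

Lemma integrable_wprod f g : fock f -> fock g ->
  mu2.-integrable setT (fun p => (wprod f g p)%:E).
Proof.
move=> /fockP[ef fi] /fockP[eg gi].
apply: le_integrable (integrableD measurableT fi gi) => //.
  by apply/measurable_EFinP; exact: measurable_wprod.
move=> p _; rewrite -EFinD !abse_EFin lee_fin.
rewrite (@ger0_norm _ (wprod f f p + _)) ?wprod_le//.
by rewrite addr_ge0// wprod_self_ge0.
Qed.

Lemma fockD f g : fock f -> fock g -> fock (fun z => f z + g z).
Proof.
move=> ff fg; have [ef fi] := (fockP f).1 ff; have [eg gi] := (fockP g).1 fg.
apply/fockP; split; first exact: entireD.
have fgi := integrable_wprod ff fg.
apply: eq_integrable (integrableD measurableT (integrableD measurableT fi gi)
  (integrableD measurableT fgi fgi)) => // p _.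
rewrite -!EFinD; congr EFin; rewrite /wprod -!mulrDl; congr (_ * _).
rewrite !complexReJ /=; case: (f _) (g _) => a b [c d] /=; ring.
Qed.

Lemma fockZ c f : fock f -> fock (fun z => c * f z).
Proof.
move=> /fockP[ef fi]; apply/fockP; split.
  by apply: entireM ef; exact: entire_cst.
apply: eq_integrable (integrableZl measurableT (normc c ^+ 2) fi) => // p _.
rewrite -EFinM; congr EFin; rewrite /wprod mulrA; congr (_ * _).
by rewrite -!sqr_normcE normcM exprMn.
Qed.

Lemma fock_ipC f g : fock_ip f g = fock_ip g f.
Proof.
congr (_ * _); apply: eq_Rintegral => p _; rewrite /wprod !complexReJ.
by congr (_ * _); ring.
Qed.

Lemma fock_ipDl f g k : fock f -> fock g -> fock k ->
  fock_ip (fun z => f z + g z) k = fock_ip f k + fock_ip g k.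
Proof.
move=> ff fg fk; rewrite /fock_ip -mulrDr; congr (_ * _).
rewrite -RintegralD//; [|exact: integrable_wprod..].
apply: eq_Rintegral => p _; rewrite /wprod -mulrDl; congr (_ * _).
rewrite !complexReJ /=; case: (f _) (g _) => a b [c d] /=; ring.
Qed.

Lemma fock_ipZl (t : R) f k : fock f -> fock k ->
  fock_ip (fun z => t%:C * f z) k = t * fock_ip f k.
Proof.
move=> ff fk; rewrite /fock_ip mulrCA; congr (_ * _).
rewrite -RintegralZl//; last exact: integrable_wprod.
apply: eq_Rintegral => p _; rewrite /wprod mulrA; congr (_ * _).
rewrite !complexReJ /=; case: (f _) => a b /=; ring.
Qed.

Lemma fock_ip_ge0 f : 0 <= fock_ip f f.
Proof.
rewrite mulr_ge0 ?invr_ge0 ?pi_ge0// Rintegral_ge0// => p _.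
exact: wprod_self_ge0.
Qed.

Lemma entire_fock_kernel w : entire (fock_kernel^~ w).
Proof.
apply: (entire_comp entire_cexp); apply: entireM; first exact: entire_id.
exact: entire_cst.
Qed.

(** Completing the square: the weighted square modulus of the kernel at [w] is
    a Gaussian recentred at [w]. *)
Lemma fock_kernel_fock w : fock (fock_kernel^~ w).
Proof.
apply/fockP; split; first exact: entire_fock_kernel.
case: w => a b.
have aT := area_preserving_translation (- a) (- b).
apply: eq_integrable (integrableZl measurableT (expR (normc (a +i* b) ^+ 2))
  (integrable_area_preserving aT integrable_gauss2)) => // -[x y] _.
rewrite -EFinM; congr EFin; rewrite /wprod -sqr_normcE normc_cexp /gauss2.
rewrite !sqr_normc_ReIm /= -expRM_natl -!expRD; congr expR; ring.
Qed.

Lemma conjcM z w : (z * w)^*%C = z^*%C * w^*%C.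
Proof. exact: rmorphM. Qed.

Lemma conj_cexp z : (cexp z)^*%C = cexp z^*%C.
Proof. by case: z => a b; rewrite /cexp /= cosN sinN mulrN. Qed.

Lemma cexp_real (t : R) : cexp t%:C = (expR t)%:C.
Proof. by rewrite /cexp /= cos0 sin0 mulr1 mulr0. Qed.

(** Completing the square around [w]: conjugated kernel times Gaussian weight is
    a holomorphic factor, equal to 1 at [u = 0], times the weight at [u]. *)
Lemma fock_kernel_recentre w u :
  (fock_kernel (w + u) w)^*%C * (expR (- normc (w + u) ^+ 2))%:C =
  cexp (- w^*%C * u) * (expR (- normc u ^+ 2))%:C.
Proof.
rewrite /fock_kernel conj_cexp -!cexp_real -!cexpD; congr cexp.
rewrite !sqr_normc_ReIm; case: w u => a b [x y].
by apply/eqP; rewrite eq_complex /=; apply/andP; split; apply/eqP; ring.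
Qed.

(** The change of variable [z = w + u] turns the integrand into the real part of
    an entire function of [u], with value [c^* g(w)] at the origin, times the
    Gaussian weight. *)
Lemma fock_reproducing c g w : fock g ->
  fock_ip g (fun z => c * fock_kernel z w) = complex.Re (c^*%C * g w).
Proof.
move=> fg; have fK := fockZ c (fock_kernel_fock w).
have gi := integrable_wprod fg fK; have [eg _] := (fockP g).1 fg.
have aT := area_preserving_translation (complex.Re w) (complex.Im w).
pose G u := c^*%C * g (w + u) * cexp (- w^*%C * u).
have eG : entire G.
  apply: entireM; last first.
    apply: (entire_comp entire_cexp); apply: entireM; last exact: entire_id.
    exact: entire_cst.
  apply: (entireM (f := fun=> c^*%C)); first exact: entire_cst.
  apply: (entire_comp eg); apply: entireD; last exact: entire_id.
  exact: entire_cst.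
have shiftE (p : plane) :
    wprod g (fun z => c * fock_kernel z w)
      (p.1 + complex.Re w, p.2 + complex.Im w) =
    complex.Re (G (p.1 +i* p.2)) * gauss2 p.
  rewrite /wprod /G -!complexRe_mulr; congr complex.Re.
  case: w {fK gi aT G eG} => a b; case: p => x y /=.
  have -> : (x + a) +i* (y + b) = (a +i* b) + (x +i* y).
    by apply/eqP; rewrite eq_complex /= ![_ + x]addrC ![_ + y]addrC !eqxx.
  have -> : gauss2 (x + a, y + b) = expR (- normc ((a +i* b) + (x +i* y)) ^+ 2).
    by rewrite /gauss2 /= ![_ + x]addrC ![_ + y]addrC.
  have := fock_kernel_recentre (a +i* b) (x +i* y).
  rewrite conjcM -[gauss2 (x, y)]/(expR (- normc (x +i* y) ^+ 2)).
  move: (g _) ((fock_kernel _ _)^*%C) (expR _)%:C => G0 K0 E0 KE.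
  transitivity (c^*%C * G0 * (K0 * E0)); first by ring.
  by rewrite KE; ring.
rewrite /fock_ip /Rintegral -(integral_area_preserving aT gi) /=.
under eq_integral do rewrite shiftE.
rewrite gaussian_mean//; last first.
  apply: eq_integrable (integrable_area_preserving aT gi) => // p _.
  by rewrite shiftE.
rewrite /= mulrCA mulVf ?mulr1 ?lt0r_neq0 ?pi_gt0//.
by rewrite /G mulr0 cexp0 mulr1 addr0.
Qed.

End FockInnerProduct.

(** * The regularized loss around a combination of kernels *)
Section RegularizedLoss.
Context {R : realType}.
Implicit Types (f g k : R[i] -> R[i]) (z c : R[i]).

(** First-order optimality along a line: take [t] a small multiple of [l]. *)
Lemma quadratic_ge0_lin0 (q l : R) :
  (forall t : R, 0 <= t ^+ 2 * q - 2 * t * l) -> l = 0.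
Proof.
move=> H; pose s := (1 + `|q|)^-1.
have q1 : 0 < 1 + `|q| by rewrite ltr_pwDl.
have := H (l * s); have -> : (l * s) ^+ 2 * q - 2 * (l * s) * l
  = (l ^+ 2 * s) * (q * s - 2) by ring.
have qs : q * s <= 1.
  rewrite ler_pdivrMr// mul1r; have := ler_norm q; lra.
have l2 : 0 <= l ^+ 2 * s by rewrite mulr_ge0 ?sqr_ge0// invr_ge0 ltW.
move=> H0; have : l ^+ 2 * s <= 0 by nra.
rewrite pmulr_lle0 ?invr_gt0// => l20; apply/eqP.
by rewrite -sqrf_eq0 eq_le l20 sqr_ge0.
Qed.

(** A null function is orthogonal to every multiple of every kernel, so the
    reproducing property makes all its values vanish. *)
Lemma fock_ip_eq0 g : fock g -> fock_ip g g = 0 -> g = fun=> 0.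
Proof.
move=> fg g0; apply/funext => w; apply: (@eq0_normc R); apply/eqP.
rewrite -sqrf_eq0; apply/eqP.
have fK := fockZ (g w) (fock_kernel_fock w).
have -> : normc (g w) ^+ 2 = fock_ip g (fun z => g w * fock_kernel z w).
  by rewrite fock_reproducing// sqr_normcE mulrC.
apply: (@quadratic_ge0_lin0 (fock_ip (fun z => g w * fock_kernel z w)
  (fun z => g w * fock_kernel z w))) => t.
set K := (fun z => g w * fock_kernel z w) in fK *.
have ft := fockZ (- t)%:C fK.
have fgt := fockD fg ft.
have := fock_ip_ge0 (fun z => g z + (- t)%:C * K z).
rewrite fock_ipDl// (fock_ipC g) fock_ipDl// g0.
rewrite (fock_ipZl (- t) fK fgt) (fock_ipC K) fock_ipDl//.
rewrite !(fock_ipZl (- t) fK)// (fock_ipC K g); lra.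
Qed.

Lemma fock_sum (I : Type) (s : seq I) (F : I -> R[i] -> R[i]) :
  (forall i, fock (F i)) -> fock (fun z => \sum_(i <- s) F i z).
Proof.
move=> FF; elim: s => [|i s IH].
  rewrite (_ : (fun _ => _) = fun z => 0 * fock_kernel z 0).
    exact/fockZ/fock_kernel_fock.
  by apply/funext => z; rewrite big_nil mul0r.
rewrite (_ : (fun _ => _) = fun z => F i z + \sum_(j <- s) F j z).
  exact: fockD.
by apply/funext => z; rewrite big_cons.
Qed.

Lemma fock_reproducing_sum (I : Type) (s : seq I) (c : I -> R[i])
    (x : I -> R[i]) g : fock g ->
  fock_ip g (fun z => \sum_(i <- s) c i * fock_kernel z (x i)) =
  complex.Re (\sum_(i <- s) (c i)^*%C * g (x i)).
Proof.
move=> fg; elim: s => [|i s IH].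
  rewrite (_ : (fun _ => _) = fun z => 0 * fock_kernel z 0).
    by rewrite fock_reproducing// big_nil conjc0 mul0r.
  by apply/funext => z; rewrite big_nil mul0r.
rewrite (_ : (fun _ => _) = fun z => c i * fock_kernel z (x i) +
    \sum_(j <- s) c j * fock_kernel z (x j)); last first.
  by apply/funext => z; rewrite big_cons.
have fK j : fock (fun z => c j * fock_kernel z (x j)).
  exact/fockZ/fock_kernel_fock.
rewrite fock_ipC fock_ipDl//; last exact: fock_sum.
rewrite ![fock_ip _ g]fock_ipC IH fock_reproducing// big_cons.
by case: (_ * _) (\sum_(_ <- _) _) => a b [].
Qed.

Context (n : nat) (zs w : 'I_n.+1 -> R[i]) (lambda : R).

(** Around a combination [f] of the kernels at the sample points, the loss is
    an exact quadratic polynomial in the perturbation: the reproducing property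
    turns the cross term of the norm into values at the sample points. *)
Lemma reg_loss_expand (Z : 'I_n.+1 -> R[i]) g : fock g ->
  let f := fun z => \sum_(j < n.+1) Z j * fock_kernel z (zs j) in
  reg_loss zs w lambda (fun z => f z + g z) =
  reg_loss zs w lambda f
  + (\sum_(k < n.+1) normc (g (zs k)) ^+ 2 + lambda * fock_ip g g)
  - 2 * complex.Re (\sum_(k < n.+1)
          (w k - f (zs k) - lambda%:C * Z k)^*%C * g (zs k)).
Proof.
move=> fg f; have ff : fock f.
  by apply: fock_sum => j; exact/fockZ/fock_kernel_fock.
have ffg := fockD ff fg.
rewrite /reg_loss !fine_fock_normsq// (fock_ipDl ff fg ffg).
rewrite !(fock_ipC _ (fun z => f z + g z)).
rewrite !fock_ipDl// (fock_ipC f g).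
have -> : fock_ip g f = complex.Re (\sum_(k < n.+1) (Z k)^*%C * g (zs k)).
  exact: fock_reproducing_sum.
have ReS (F : 'I_n.+1 -> R[i]) :
    complex.Re (\sum_k F k) = \sum_k complex.Re (F k).
  by apply: (big_morph (@complex.Re R)) => // -[a b] [c d].
rewrite !ReS.
have -> : \sum_(k < n.+1) normc (w k - (f (zs k) + g (zs k))) ^+ 2 =
  \sum_(k < n.+1) normc (w k - f (zs k)) ^+ 2 +
  \sum_(k < n.+1) normc (g (zs k)) ^+ 2
  - 2 * (\sum_(k < n.+1)
      complex.Re ((w k - f (zs k) - lambda%:C * Z k)^*%C * g (zs k))
    + lambda * \sum_(k < n.+1) complex.Re ((Z k)^*%C * g (zs k))).
  rewrite mulr_sumr -!big_split /= mulr_sumr -sumrB.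
  apply: eq_bigr => k _; rewrite !sqr_normc_ReIm.
  case: (w k) (f _) (g _) (Z k) => a1 b1 [a2 b2] [a3 b3] [a4 b4] /=; ring.
ring.
Qed.

End RegularizedLoss.

Section LearningProblem.
Context {R : realType}.

Lemma fock_kernel_imaginary (s t : R) :
  fock_kernel (- 'i%C * s%:C) (- 'i%C * t%:C) = (expR (t * s))%:C.
Proof.
rewrite /fock_kernel -cexp_real; congr cexp.
by apply/eqP; rewrite eq_complex /=; apply/andP; split; apply/eqP; ring.
Qed.

(** The functions [z |-> p (exp (i z))], with [p] a polynomial, are
    combinations of kernels; a polynomial vanishing at all but one of the
    numbers [exp (h_j)] isolates one sample point. *)
Lemma fock_isolate (n : nat) (h : nat -> R) (k : 'I_n.+1) :
  injective (fun j : 'I_n.+1 => - 'i%C * (h j)%:C) ->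
  exists g, [/\ fock g, g (- 'i%C * (h k)%:C) != 0 &
    forall j : 'I_n.+1, j != k -> g (- 'i%C * (h j)%:C) = 0].
Proof.
move=> inj; pose p := \prod_(j < n.+1 | j != k) ('X - (expR (h j))%:P).
pose g z := \sum_(m < size p) (p`_m)%:C * fock_kernel z (- 'i%C * (m%:R)%:C).
have gE t : g (- 'i%C * t%:C) = (p.[expR t])%:C.
  rewrite horner_coef rmorph_sum; apply: eq_bigr => m _.
  by rewrite fock_kernel_imaginary expRM_natl -rmorphM.
exists g; split.
- by apply: fock_sum => m; exact/fockZ/fock_kernel_fock.
- rewrite gE -(rmorph0 (real_complex R)) (inj_eq (@complexI R)).
  rewrite horner_prod; apply/prodf_neq0 => j jk.
  rewrite hornerXsubC subr_eq0; apply: contra jk => /eqP/expR_inj hkj.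
  by apply/eqP/inj; rewrite hkj.
- move=> j jk; rewrite gE horner_prod (bigD1 j)//= hornerXsubC subrr mul0r.
  exact: rmorph0.
Qed.

End LearningProblem.

Theorem theorem4p3 (R : realType) (n : nat) (a lambda : R)
    (h : nat -> nat -> R) (Z : nat -> nat -> R -> R[i])
    (n_gt0 : (0 < n)%N) (a_gt1 : 1 < a) (lambda_gt0 : 0 < lambda)
    (h_le1 : forall m j : nat, (0 < m)%N -> `|h m j| <= 1)
    (f_superosc : superoscillating h Z a)
    (w : 'I_n.+1 -> R[i]) :
  let zs := fun k : 'I_n.+1 => - 'i%C * (h n k)%:C in
  let solves := argmin fock (reg_loss zs w lambda) = [set fock_seq h Z a n] in
  let formula := forall k : 'I_n.+1,
    w k = \sum_(j < n.+1) Z n j a * (expR (h n j * h n k))%:C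
          + lambda%:C * Z n k a in
  (formula -> solves) /\ (injective zs -> solves -> formula).
Proof.
move=> zs solves formula.
pose f := fock_seq h Z a n; pose J := reg_loss zs w lambda.
pose c k := w k - f (zs k) - lambda%:C * Z n k a.
have ff : fock f by apply: fock_sum => j; exact/fockZ/fock_kernel_fock.
have fE k : f (zs k) = \sum_(j < n.+1) Z n j a * (expR (h n j * h n k))%:C.
  by apply: eq_bigr => j _; rewrite fock_kernel_imaginary.
have formulaE : formula <-> forall k, c k = 0.
  split=> H k; first by rewrite /c fE (H k) -addrA -opprD subrr.
  by have /eqP := H k; rewrite /c -addrA -opprD subr_eq0 -fE => /eqP.
have JE g : fock g -> J (fun z => f z + g z) = J f +
    (\sum_(k < n.+1) normc (g (zs k)) ^+ 2 + lambda * fock_ip g g) -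
    2 * complex.Re (\sum_(k < n.+1) (c k)^*%C * g (zs k)).
  by move=> fg; exact: reg_loss_expand.
have Q0 (g : R[i] -> R[i]) : 0 <= \sum_(k < n.+1) normc (g (zs k)) ^+ 2.
  by apply: sumr_ge0 => k _; exact: sqr_ge0.
split.
- move=> /formulaE c0.
  have fdiff k : fock k -> fock (fun z => k z - f z).
    move=> fk; rewrite (_ : (fun _ => _) = fun z => k z + (-1) * f z).
      exact/fockD/fockZ.
    by apply/funext => z; rewrite mulN1r.
  have JE0 k : fock k -> J k = J f + (\sum_(i < n.+1)
      normc (k (zs i) - f (zs i)) ^+ 2 +
      lambda * fock_ip (fun z => k z - f z) (fun z => k z - f z)).
    move=> fk; have := JE _ (fdiff k fk).
    rewrite (_ : (fun z => f z + _) = k); last first.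
      by apply/funext => z; rewrite subrKC.
    move=> ->; under [X in complex.Re X]eq_bigr do rewrite c0 conjc0 mul0r.
    by rewrite big1_eq mulr0 subr0.
  apply/seteqP; split => [k [fk kmin]|_ ->]; last first.
    split=> // k fk; rewrite -/J (JE0 k fk) lerDl.
    apply: addr_ge0; first exact: (Q0 (fun z => k z - f z)).
    by apply: mulr_ge0; [exact: ltW|exact: fock_ip_ge0].
  have := kmin _ ff; rewrite -/J (JE0 k fk) gerDl => Qle.
  have /(fock_ip_eq0 (fdiff k fk)) kf :
      fock_ip (fun z => k z - f z) (fun z => k z - f z) = 0.
    apply/eqP; rewrite eq_le fock_ip_ge0 andbT -(pmulr_rle0 _ lambda_gt0).
    by apply: le_trans Qle; rewrite lerDr; exact: (Q0 (fun z => k z - f z)).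
  apply/funext => z; apply/eqP; rewrite -subr_eq0; apply/eqP.
  exact: (congr1 (fun u : R[i] -> R[i] => u z) kf).
- move=> inj sol; apply/formulaE => k.
  have fmin : argmin fock J f by rewrite /J sol.
  (* first-order condition: the linear term vanishes in every direction *)
  have crit g : fock g -> complex.Re (\sum_(k < n.+1) (c k)^*%C * g (zs k)) = 0.
    move=> fg; set L := complex.Re _.
    apply: (@quadratic_ge0_lin0 R
      (\sum_(k < n.+1) normc (g (zs k)) ^+ 2 + lambda * fock_ip g g)) => t.
    have ft := fockZ t%:C fg.
    have := fmin.2 _ (fockD ff ft); rewrite JE//.
    rewrite fock_ipZl// fock_ipC fock_ipZl//.
    have -> : \sum_(k < n.+1) normc (t%:C * g (zs k)) ^+ 2 =
        t ^+ 2 * \sum_(k < n.+1) normc (g (zs k)) ^+ 2.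
      rewrite mulr_sumr; apply: eq_bigr => j _.
      rewrite normcM exprMn; congr (_ * _).
      by rewrite sqr_normc_ReIm /= expr0n addr0.
    have -> : \sum_(k < n.+1) (c k)^*%C * (t%:C * g (zs k)) =
        (\sum_(k < n.+1) (c k)^*%C * g (zs k)) * t%:C.
      by rewrite mulr_suml; apply: eq_bigr => j _; rewrite mulrCA mulrC.
    rewrite complexRe_mulr -/L; lra.
  have [g [fg gk gj]] := fock_isolate k inj.
  have := crit _ (fockZ (c k / g (zs k)) fg).
  rewrite (bigD1 k)//= big1; last first.
    by move=> j jk; rewrite (gj j jk : g (zs j) = 0) !mulr0.
  rewrite addr0 divfK// mulrC -sqr_normcE => /eqP.
  by rewrite sqrf_eq0 => /eqP/eq0_normc.
Qed.
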